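(* Let $\mathcal{H}$ be a real Hilbert space, let $A, B: \mathcal{H} \rightrightarrows \mathcal{H}$ be maximally monotone operators, let $D: \mathcal{H} \to \mathcal{H}$ be a monotone and $\eta^{-1}$-Lipschitz continuous operator with $\eta > 0$, and suppose that $C := \operatorname{zer} B \neq \emptyset$. Let $(\lambda_n)_{n \in \mathbb{N}}$ and $(\beta_n)_{n\in\mathbb{N}}$ be sequences of positive real numbers. Assume that: (i) $A + N_C$ is maximally monotone and $\operatorname{zer}(A + D + N_C) \neq \emptyset$; (ii) for every $p \in \operatorname{Ran} N_C$, $\displaystyle\sum_{n \in \mathbb{N}} \lambda_n \beta_n \left( \sup_{\tilde u \in C} \varphi_B\left(\tilde u, \frac{p}{\beta_n}\right) - \sigma_C\left(\frac{p}{\beta_n}\right) \right) < +\infty$; (iii) $(\lambda_n)_{n\in\mathbb{N}} \in \ell^2 \setminus \ell^1$. Let $x_1 \in \mathcal{H}$ be arbitrary and let $(x_n)_{n\in\mathbb{N}}$, $(y_n)_{n\in\mathbb{N}}$, $(p_n)_{n\in\mathbb{N}}$, $(q_n)_{n\in\mathbb{N}}$ be generated, for all $n \geq 1$, by $$y_n = x_n - \lambda_n D x_n, \quad p_n = J_{\lambda_n A}\, y_n, \quad q_n = p_n - \lambda_n D p_n, \quad x_{n+1} = J_{\lambda_n \beta_n B}(x_n - y_n + q_n).$$ If the operator $A$ is $\gamma$-strongly monotone with $\gamma > 0$, then $(x_n)_{n\in\mathbb{N}}$ converges strongly to the unique element of $\operatorname{zer}(A+D+N_C)$ as $n \to +\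infty$.
   Context: $\mathbb{N} = \{1,2,\ldots\}$. For a set-valued operator $M:\mathcal{H} \rightrightarrows \mathcal{H}$: $\operatorname{Graph} M = \{(x,u) : u \in Mx\}$, $\operatorname{Ran} M = \bigcup_{x\in\mathcal{H}} Mx$, $\operatorname{zer} M = \{x : 0 \in Mx\}$. $M$ is monotone if $\langle x-y, u-v\rangle \ge 0$ for all $(x,u),(y,v)\in\operatorname{Graph} M$, and maximally monotone if moreover its graph has no proper monotone extension in $\mathcal{H}\times\mathcal{H}$. $M$ is $\gamma$-strongly monotone if $\langle x-y,u-v\rangle\ge\gamma\|x-y\|^2$ for all $(x,u),(y,v)\in\operatorname{Graph} M$. The resolvent is $J_M = (\operatorname{Id}+M)^{-1}$, which is single-valued with full domain when $M$ is maximally monotone. The normal cone is $N_C(x)=\{u : \langle u,y-x\rangle\le 0 \text{ for all } y\in C\}$ if $x\in C$ and $N_C(x)=\emptyset$ otherwise; the support function is $\sigma_C(u)=\sup_{y\in C}\langle u,y\rangle$. The Fitzpatrick function of $B$ is $\varphi_B(x,u)=\sup\{\langle x,v\rangle+\langle y,u\rangle-\langle y,v\rangle : (y,v)\in\operatorname{Graph} B\}$, with values in $\mathbb{R}\cup\{\pm\infty\}$. *)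

(* Defs.v *)
From HB Require Import structures.
From mathcomp Require Import all_boot all_order all_algebra.
From mathcomp Require Import all_classical all_reals all_analysis.
Import Order.TTheory GRing.Theory Num.Theory.
Import numFieldNormedType.Exports.

Set Implicit Arguments.
Unset Strict Implicit.
Unset Printing Implicit Defensive.

Local Open Scope classical_set_scope.
Local Open Scope ring_scope.

(* A real Hilbert space is a complete normed module [H] over [R : realType]
   with an inner product [inner : {dot H for idfun}] that induces its norm. *)

Section SetValued.
Variables (R : realType) (H : completeNormedModType R).

Definition setop := H -> set H.

Implicit Types (M N : setop) (D : H -> H).

Definition graph M : set (H * H) := [set xu | M xu.1 xu.2].
Definition ran M : set H := \bigcup_x M x.
Definition zer M : set H := [set x | M x 0].

Definition single D : setop := fun x => [set D x].
Definition op_inv M : setop := fun u => [set x | M x u].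
Definition op_add M N : setop := fun x => [set u + v | u in M x & v in N x].
Definition op_scale (a : R) M : setop := fun x => [set a *: u | u in M x].

Definition resolvent M : setop := op_inv (op_add (single id) M).

End SetValued.

Section Hilbert.
Variables (R : realType) (H : completeNormedModType R).
Variable inner : {dot H for idfun}.

Implicit Types (M : setop H) (C : set H).

Definition strongly_monotone_op (gamma : R) M :=
  forall x u y v, graph M (x, u) -> graph M (y, v) ->
    gamma * `|x - y| ^+ 2 <= inner (x - y) (u - v).

Definition monotone_op M :=
  forall x u y v, graph M (x, u) -> graph M (y, v) ->
    0 <= inner (x - y) (u - v).

Definition maximally_monotone_op M :=
  monotone_op M /\
  forall M' : setop H, monotone_op M' -> graph M `<=` graph M' ->
    graph M' = graph M.

Definition normal_cone C : setop H := fun x =>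
  [set u | C x /\ forall y, C y -> inner u (y - x) <= 0].

Definition support_fun C (u : H) : \bar R :=
  ereal_sup [set (inner u y)%:E | y in C].

Definition fitzpatrick M (x u : H) : \bar R :=
  ereal_sup [set (inner x yv.2 + inner yv.1 u - inner yv.1 yv.2)%:E
            | yv in graph M].

End Hilbert.

(* Sequences are indexed by the positive integers: the value at [0] of a
   function on [nat] is ignored. *)
Definition ell (R : realType) (k : nat) : set (nat -> R) :=
  [set u | (\sum_(1 <= n <oo) (`|u n| ^+ k)%:E < +oo)%E].

(* Main.v *)
Require Import Defs.
From HB Require Import structures.
From mathcomp Require Import all_boot all_order all_algebra.
From mathcomp Require Import all_classical all_reals all_analysis.
From mathcomp Require Import ring lra.
Import Order.TTheory GRing.Theory Num.Theory.
Import numFieldNormedType.Exports.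

Local Open Scope classical_set_scope.
Local Open Scope ring_scope.

(** Fix a zero [z] of [A + D + N_C], decomposed as [a0 + D z + r = 0] with
    [a0] in [A z] and [r] in [N_C z].  The proof is a Lyapunov argument on
    [`|x n - z| ^+ 2].

    Write one iteration as [x' = x - l a - l D p - l b v] with [a] in [A p] and
    [v] in [B x'].  Pairing [a] with [a0] through the strong monotonicity of [A]
    yields a gain [2 l gamma |p - z|^2]; pairing [D p] with [D z] costs nothing.
    What is left of the backward step on [B] is, up to the factor [l],
    [<r, x' - z> - b <x' - z, v>], and this is dominated by the gap between the
    Fitzpatrick function of [B] and the support function of [C] at [r / b]
    ([fitzpatrick_gap_ge]); by hypothesis these gaps, weighted by [l b], are
    summable.  The remaining cross terms pair [x' - p] with [l r] and with
    [l (D p - D x)]; completing squares absorbs them, at the cost of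
    [2 l^2 |r|^2], which is summable, and of a fraction of [|x - p|^2], which is
    available as soon as [l] is small.  Since [|x - z|^2] is at most
    [2 |x - p|^2 + 2 |p - z|^2], the two gains bound [gamma l |x - z|^2], whence
    ([tseng_penalty_step]), for all large [n],
      [|x' - z|^2 + gamma l |x - z|^2 <= |x - z|^2 + e]
    with [e] summable.

    The step sizes are not summable, so [`|x n - z|] cannot stay away from
    [0]; the summability of [e] turns this into convergence
    ([perturbed_descent_cvg0]).  The argument applies to every zero [z], so
    uniqueness of the zero is the uniqueness of the limit of [x]. *)

Set Implicit Arguments.
Unset Strict Implicit.

(** * Nonnegative series and perturbed descent *)

(** If [a] stayed above some positive bound from some point on, summing the
    recursion would bound the partial sums of [l].  So [a] takes arbitrarily
    small values at arbitrarily late indices, and after such an index it grows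
    by at most a tail of the series of [e]. *)
Lemma perturbed_descent_cvg0 (R : realType) (a l e : nat -> R) :
    (forall n, 0 <= a n) -> (forall n, 0 <= l n) ->
    (\forall n \near \oo, a n.+1 + l n * a n <= a n + e n) ->
    cvgn (series e) -> ~ cvgn (series l) ->
  a @ \oo --> 0.
Proof.
move=> a_ge0 l_ge0 [N0 _ descent] cvg_e dvg_l.
have sum_descent m n : (N0 <= m)%N ->
    a (n + m)%N + \sum_(m <= k < n + m) l k * a k <=
      a m + \sum_(m <= k < n + m) e k.
  move=> le_m; elim: n => [|n IH]; first by rewrite add0n !big_geq.
  rewrite addSn !big_nat_recr ?leq_addl//=.
  have := descent (n + m)%N (leq_trans le_m (leq_addl _ _)).
  lra.
apply/cvgr0Pnorm_le => eps eps_gt0.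
have eps2_gt0 : 0 < eps / 2 by rewrite divr_gt0.
have [[P1 P2] [[N1 _ PN1] [N2 _ PN2]] tail_e] :=
  (cauchy_seriesP e).1 (cvg_cauchy _ cvg_e) _ eps2_gt0.
pose N := maxn N0 (maxn N1 N2).
have tail m n : (N <= m)%N -> \sum_(m <= k < n + m) e k <= eps / 2.
  rewrite !geq_max => /and3P[_ m1 m2].
  have := tail_e (m, (n + m)%N) (conj (PN1 _ m1) (PN2 _ (leq_trans m2 (leq_addl _ _)))).
  by move=> /ltW; apply: le_trans; exact: ler_norm.
(* The tails of [e] are small beyond [N]; it remains to find a small value
   of [a] there. *)
have [m Nm am] : exists2 m, (N <= m)%N & a m <= eps / 2.
  apply: contrapT => no_m; apply: dvg_l.
  apply: nondecreasing_is_cvgn.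
    by apply: nondecreasing_series => n _ _.
  exists (series l N + (a N + eps / 2) / (eps / 2)) => _ [n _ <-].
  have le_nN : series l n <= series l (n + N)%N.
    apply: (nondecreasing_series (P := xpredT)) => //; exact: leq_addr.
  apply: le_trans le_nN _; rewrite series_addn lerD2l.
  rewrite ler_pdivlMr// mulr_suml.
  have N0N : (N0 <= N)%N by rewrite leq_max leqnn.
  have := sum_descent N n N0N; have := tail N n (leqnn _); have := a_ge0 (n + N)%N.
  have : \sum_(N <= k < n + N) l k * (eps / 2) <= \sum_(N <= k < n + N) l k * a k.
    rewrite big_nat [leRHS]big_nat; apply: ler_sum => k /andP[Nk _].
    apply: ler_wpM2l => //; rewrite leNgt; apply/negP => /ltW ak.
    by apply: no_m; exists k.
  lra.
exists m => // n /= /subnK <-; rewrite ger0_norm//.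
have := sum_descent m (n - m)%N (leq_trans _ Nm); rewrite leq_max leqnn => /(_ isT).
have := tail m (n - m)%N Nm.
have : 0 <= \sum_(m <= k < n - m + m) l k * a k by apply: sumr_ge0 => k _; rewrite mulr_ge0.
lra.
Qed.

Lemma nneseries1_fin_num (R : realType) (t : (\bar R)^nat) :
    (forall n, (0 <= t n.+1)%E) -> (\sum_(1 <= n <oo) t n < +oo)%E ->
  forall n, t n.+1 \is a fin_num.
Proof.
move=> t_ge0 t_fin n; rewrite ge0_fin_numE//.
apply: le_lt_trans t_fin.
apply: le_trans (nneseries_lim_ge (P := xpredT) n.+2 _); last by case.
rewrite big_nat_recr//= leeDr// big_nat sume_ge0 => //; by case.
Qed.

(** The value [t 0] may be any extended real, even a negative one: sequences
    indexed from [1] carry no information there, hence the shift. *)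
Lemma nneseries1_cvg (R : realType) (t : (\bar R)^nat) :
    (forall n, (0 <= t n.+1)%E) -> (\sum_(1 <= n <oo) t n < +oo)%E ->
  cvgn (series (fun n => fine (t n.+1))).
Proof.
move=> t_ge0 t_fin; have fin := nneseries1_fin_num t_ge0 t_fin.
apply: nondecreasing_is_cvgn.
  by apply: nondecreasing_series => n _ _; rewrite fine_ge0.
exists (fine (\sum_(1 <= n <oo) t n)%E) => _ [n _ <-].
have t_sum_fin : (\sum_(1 <= n <oo) t n)%E \is a fin_num.
  by rewrite ge0_fin_numE//; apply: nneseries_ge0; case.
rewrite -lee_fin fineK// /series/= -sumEFin.
under eq_bigr do rewrite fineK//.
rewrite -(big_add1 _ _ 0 n.+1 xpredT).
by apply: (nneseries_lim_ge (P := xpredT)); case.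
Qed.

Lemma cvg_nneseries1_lty (R : realType) (u : R^nat) :
    (forall n, 0 <= u n.+1) -> cvgn (series (fun n => u n.+1)) ->
  (\sum_(1 <= n <oo) (u n)%:E < +oo)%E.
Proof.
move=> u_ge0 cvg_u; apply: le_lt_trans (ltry (limn (series (fun n => u n.+1)))).
apply: lime_le; first by apply: is_cvg_nneseries; case=> // n _ _; rewrite lee_fin.
exists 1%N => // -[//|n] _; rewrite /= big_add1/= sumEFin lee_fin.
apply: nondecreasing_cvgn_le => //.
by apply: nondecreasing_series => k _ _.
Qed.

(** * Inner product, normal cone and Fitzpatrick function *)

Section InnerProduct.
Variables (R : realType) (H : completeNormedModType R).
Variable inner : {dot H for idfun}.

Lemma innerC u v : inner u v = inner v u.
Proof. by rewrite hermC /= expr0 mul1r. Qed.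

Lemma innerDr u v w : inner u (v + w) = inner u v + inner u w.
Proof. exact: linearDr. Qed.

Lemma innerNr u v : inner u (- v) = - inner u v.
Proof. exact: linearNr. Qed.

Lemma innerZr a u v : inner u (a *: v) = a * inner u v.
Proof. exact: linearZr_LR. Qed.

Definition inner_expandr := (innerDr, innerNr, innerZr).

Lemma innerDl u v w : inner (u + v) w = inner u w + inner v w.
Proof. exact: linearDl. Qed.

Lemma innerNl u v : inner (- u) v = - inner u v.
Proof. exact: linearNl. Qed.

Lemma innerZl a u v : inner (a *: u) v = a * inner u v.
Proof. exact: linearZl_LR. Qed.

Definition inner_expandl := (innerDl, innerNl, innerZl).

Lemma support_fun_normal_cone (C : set H) z u :
  normal_cone inner C z u -> support_fun inner C u = (inner u z)%:E.
Proof.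
move=> [Cz uC]; apply/eqP; rewrite eq_le; apply/andP; split.
  apply: ge_ereal_sup => _ [y Cy <-]; rewrite lee_fin -subr_ge0 -oppr_le0 opprB.
  by rewrite -linearBr uC.
by apply: ereal_sup_ubound; exists z.
Qed.

Lemma normal_coneZ (C : set H) z u (a : R) :
  0 <= a -> normal_cone inner C z u -> normal_cone inner C z (a *: u).
Proof.
move=> a_ge0 [Cz uC]; split => // y Cy.
by rewrite linearZl_LR /= mulr_ge0_le0// uC.
Qed.

(** The left-hand side is the value of the competitor [(y, v)] in the supremum defining the
    Fitzpatrick function at [(z, u)], minus the support function at [u].  When
    [z] is a zero of [B], the choice [(y, v) = (z, 0)] makes it vanish, so the
    gap is nonnegative. *)
Lemma fitzpatrick_gap_ge (B : setop H) (C : set H) z u y v :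
    normal_cone inner C z u -> graph B (y, v) ->
  ((inner u (y - z) - inner (y - z) v)%:E <=
    ereal_sup [set fitzpatrick inner B w u | w in C] - support_fun inner C u)%E.
Proof.
move=> uN Byv; have [Cz _] := uN.
rewrite (support_fun_normal_cone uN) leeBrDr// -EFinD.
apply: le_trans (ereal_sup_ubound _); last by exists z.
apply: le_trans (ereal_sup_ubound _); last by exists (y, v).
rewrite /= lee_fin linearBr linearBl /= (innerC y u); lra.
Qed.

(** * One iteration of the algorithm *)

Hypothesis inner_norm : forall z : H, `|z| ^+ 2 = inner z z.

Lemma inner_ge0 u : 0 <= inner u u.
Proof. by rewrite -inner_norm sqr_ge0. Qed.

(** The analytic core of an iteration, with [P = p - z], [U = x - p],
    [V = x' - p] and [E = D p - D x], so that [x - z = P + U] and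
    [x' - z = P + V].  The last two hypotheses are what monotonicity gives for
    the forward-backward step on [A] and [D] and for the backward step on [B].
    Their sum, doubled, contains the terms [2 * inner P U] and [2 * inner P V]
    by which the expansions of the two squared distances differ; only the cross
    terms of [V] with [r] and [E] remain, and [inner V V] absorbs them. *)
Lemma energy_descent (l gamma L g : R) (P U V E r : H) :
    0 <= l -> 0 <= gamma -> l ^+ 2 * (4 * L ^+ 2 + 16 * gamma ^+ 2) <= 1 ->
    inner E E <= L ^+ 2 * inner U U ->
    l * (gamma * inner P P) <= inner P U + l * inner P E + l * inner P r ->
    l * inner (P + V) r + l * inner (P + V) E + inner (P + V) V <= g ->
  inner (P + V) (P + V) + gamma * l * inner (P + U) (P + U) <=
    inner (P + U) (P + U) + 2 * (inner r r * l ^+ 2 + g).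
Proof.
move=> l_ge0 gamma_ge0 l_small lip fwd bwd.
have UU_ge0 := inner_ge0 U; have PP_ge0 := inner_ge0 P.
have gammal_ge0 : 0 <= gamma * l by rewrite mulr_ge0.
have gammal_small : 4 * (gamma * l) <= 1.
  rewrite -(ler_sqr (_ : _ \is Num.nneg)) ?nnegrE ?ler01 ?mulr_ge0//.
  have := mulr_ge0 (sqr_ge0 l) (sqr_ge0 L); rewrite expr1n; nra.
have lL_small : 4 * (l ^+ 2 * L ^+ 2) <= 1.
  have := mulr_ge0 (sqr_ge0 l) (sqr_ge0 gamma); lra.
(* The available [|U|^2] is split in two halves: one pays for [2 * l^2 * |E|^2],
   the other for the [U]-part of
   [gamma * l * |P + U|^2 <= 2 * gamma * l * (|P|^2 + |U|^2)]. *)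
have lipU := ler_wpM2l (sqr_ge0 l) lip.
have UL := ler_wpM2r UU_ge0 lL_small.
have Ugamma := ler_wpM2r UU_ge0 gammal_small.
(* Half of [inner V V] absorbs the cross term with [r], half the one with [E]. *)
have sqr_r := inner_ge0 (V + (2 * l) *: r).
have sqr_E := inner_ge0 (V + (2 * l) *: E).
have sqr_PU := mulr_ge0 gammal_ge0 (inner_ge0 (P - U)).
move: fwd bwd sqr_r sqr_E sqr_PU.
rewrite !inner_expandl !inner_expandr.
rewrite (innerC U P) (innerC V P) (innerC r V) (innerC E V).
lra.
Qed.

(** One pass through the algorithm, with selections [a] in [A p], [v] in [B x']
    and [a0] in [A z] made explicit: the hypotheses keep only the inequalities
    that monotonicity and Lipschitz continuity provide at these points. *)
Lemma tseng_penalty_step (l b g gamma L : R) (p x x' a v dx dp z a0 dz r : H) :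
    0 < l -> 0 <= gamma -> l ^+ 2 * (4 * L ^+ 2 + 16 * gamma ^+ 2) <= 1 ->
    p + l *: a = x - l *: dx ->
    x' + (l * b) *: v = p + l *: (dx - dp) ->
    a0 + dz + r = 0 ->
    `|dp - dx| <= L * `|p - x| ->
    gamma * `|p - z| ^+ 2 <= inner (p - z) (a - a0) ->
    0 <= inner (p - z) (dp - dz) ->
    l * (inner r (x' - z) - b * inner (x' - z) v) <= g ->
  `|x' - z| ^+ 2 + gamma * l * `|x - z| ^+ 2 <=
    `|x - z| ^+ 2 + 2 * (`|r| ^+ 2 * l ^+ 2 + g).
Proof.
move=> l_gt0 gamma_ge0 l_small pE x'E zE lip A_strong D_mono gap.
have ->: x - z = (p - z) + (x - p) by rewrite (addrC (p - z)) addrA subrK.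
have x'zE : x' - z = (p - z) + (x' - p) by rewrite (addrC (p - z)) addrA subrK.
rewrite x'zE !inner_norm.
apply: (@energy_descent _ _ L _ _ _ _ (dp - dx)) => //; first exact: ltW.
- rewrite -!inner_norm -exprMn (distrC x) lerXn2r// ?nnegrE//.
  exact: le_trans lip.
- have laE : l *: a = x - l *: dx - p by rewrite -pE addrC addKr.
  have rE : r = - a0 - dz.
    by apply/eqP; rewrite -opprD -addr_eq0 addrC zE.
  have := ler_wpM2l (ltW l_gt0) A_strong.
  have := mulr_ge0 (ltW l_gt0) D_mono.
  rewrite inner_norm -(innerZr l _ (a - a0)) scalerBr laE rE.
  move: (p - z) => P; rewrite !inner_expandr; lra.
- rewrite -x'zE.
  have lbvE : (l * b) *: v = p + l *: (dx - dp) - x' by rewrite -x'E addrC addKr.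
  move: gap; rewrite mulrBr (mulrA l b) -(innerZr (l * b)) lbvE innerC.
  move: (x' - z) => W; rewrite !inner_expandr; lra.
Qed.

End InnerProduct.

(** * Strong convergence *)

Unset Implicit Arguments.
Set Strict Implicit.

Theorem theorem4 (R : realType) (H : completeNormedModType R)
  (inner : {dot H for idfun})
  (inner_norm : forall z : H, `|z| ^+ 2 = inner z z)
  (A B : setop H)
  (A_max : maximally_monotone_op inner A) (B_max : maximally_monotone_op inner B)
  (D : H -> H) (eta : R) (eta_gt0 : 0 < eta)
  (D_mono : monotone_op inner (single D)) (D_lip : (eta^-1).-lipschitz D)
  (C : set H) (C_def : C = zer B) (C_neq0 : C !=set0)
  (lambda beta : nat -> R)
  (lambda_gt0 : forall n, (1 <= n)%N -> 0 < lambda n)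
  (beta_gt0 : forall n, (1 <= n)%N -> 0 < beta n)
  (A_NC_max : maximally_monotone_op inner (op_add A (normal_cone inner C)))
  (zer_neq0 : zer (op_add (op_add A (single D)) (normal_cone inner C)) !=set0)
  (fitzpatrick_cond : forall p : H, ran (normal_cone inner C) p ->
    (\sum_(1 <= n <oo) ((lambda n * beta n)%:E *
       (ereal_sup [set fitzpatrick inner B u ((beta n)^-1 *: p) | u in C]
        - support_fun inner C ((beta n)^-1 *: p))) < +oo)%E)
  (lambda_ell : (ell 2 `\` ell 1) lambda)
  (x y p q : nat -> H)
  (yE : forall n, (1 <= n)%N -> y n = x n - lambda n *: D (x n))
  (pE : forall n, (1 <= n)%N ->
    resolvent (op_scale (lambda n) A) (y n) (p n))
  (qE : forall n, (1 <= n)%N -> q n = p n - lambda n *: D (p n))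
  (xE : forall n, (1 <= n)%N ->
    resolvent (op_scale (lambda n * beta n) B) (x n - y n + q n) (x n.+1))
  (gamma : R) (gamma_gt0 : 0 < gamma)
  (A_strong : strongly_monotone_op inner gamma A) :
  exists z : H,
    zer (op_add (op_add A (single D)) (normal_cone inner C)) = [set z] /\
    x @ \oo --> z.
Proof.
suff cvg_zer z : zer (op_add (op_add A (single D)) (normal_cone inner C)) z ->
    x @ \oo --> z.
  have [z zZ] := zer_neq0; exists z; split; last exact: cvg_zer.
  apply/seteqP; split => [w wZ|_ ->//].
  exact: (cvg_unique _ (cvg_zer _ wZ) (cvg_zer _ zZ)).
move=> [_ [a0 Aa0 [_ -> <-]] [r Nr zE]].
have [Cz _] := Nr; have Bz0 : graph B (z, 0) by move: Cz; rewrite C_def.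
have beta_Nr n : normal_cone inner C z ((beta n.+1)^-1 *: r).
  by apply: normal_coneZ => //; rewrite invr_ge0 ltW// beta_gt0.
pose t n := ((lambda n * beta n)%:E *
  (ereal_sup [set fitzpatrick inner B u ((beta n)^-1 *: r) | u in C]
   - support_fun inner C ((beta n)^-1 *: r)))%E.
have lb_ge0 n : (0 <= (lambda n.+1 * beta n.+1)%:E)%E.
  by rewrite lee_fin mulr_ge0// ltW// ?lambda_gt0// beta_gt0.
have t_ge0 n : (0 <= t n.+1)%E.
  apply: mule_ge0 => //; have := fitzpatrick_gap_ge (beta_Nr n) Bz0.
  by rewrite subrr linear0r linear0l subr0.
have t_fin : (\sum_(1 <= n <oo) t n < +oo)%E.
  by apply: fitzpatrick_cond; exists z.
have cvg_t := nneseries1_cvg t_ge0 t_fin.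
have normr_lambda n : `|lambda n.+1| = lambda n.+1.
  by rewrite gtr0_norm// lambda_gt0.
have cvg_lambda2 : cvgn (series (fun n => lambda n.+1 ^+ 2)).
  rewrite -(_ : (fun n => fine (`|lambda n.+1| ^+ 2)%:E) = (fun n => lambda n.+1 ^+ 2)).
    apply: (@nneseries1_cvg _ (fun n => (`|lambda n| ^+ 2)%:E)); last exact: lambda_ell.1.
    by move=> n; rewrite lee_fin sqr_ge0.
  by apply/funext => n /=; rewrite normr_lambda.
have dvg_lambda : ~ cvgn (series (fun n => gamma * lambda n.+1)).
  move=> /(is_cvg_seriesZ (k := gamma^-1)) cvg_lambda; apply: lambda_ell.2.
  rewrite /ell/=; apply: (@cvg_nneseries1_lty _ (fun n => `|lambda n| ^+ 1)) => //.
  rewrite (_ : (fun n => _) = gamma^-1 *: (fun n => gamma * lambda n.+1))//.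
  apply/funext => n; rewrite expr1 normr_lambda.
  by rewrite fctE /GRing.scale/= mulKf// gt_eqF.
suff sqr_cvg : `|x n.+1 - z| ^+ 2 @[n --> \oo] --> 0.
  rewrite -(cvg_shiftS x); apply/cvgrPdist_lt => eps eps_gt0.
  have eps2_gt0 : 0 < eps ^+ 2 by rewrite exprn_gt0.
  move/cvgr0_norm_lt : sqr_cvg => /(_ _ eps2_gt0).
  apply: filterS => n /=; rewrite ger0_norm ?sqr_ge0// distrC.
  by rewrite ltr_pXn2r ?nnegrE// ltW.
apply: (@perturbed_descent_cvg0 _ _ (fun n => gamma * lambda n.+1)
  (fun n => 2 * (`|r| ^+ 2 * lambda n.+1 ^+ 2 + fine (t n.+1)))) => //.
- by move=> n; rewrite mulr_ge0// ltW// lambda_gt0.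
(* As the squared step sizes tend to [0], they are eventually below any
   threshold, in particular the one required by the one-step estimate. *)
- pose K := 4 * eta^-1 ^+ 2 + 16 * gamma ^+ 2.
  have K_gt0 : 0 < K by rewrite addr_gt0// mulr_gt0// exprn_gt0// invr_gt0.
  have Ki_gt0 : 0 < K^-1 by rewrite invr_gt0.
  have /cvgr0_norm_lt/(_ _ Ki_gt0) := cvg_series_cvg_0 cvg_lambda2.
  apply: filterS => n; rewrite ger0_norm ?sqr_ge0// => /ltW lambda_small.
  have [_ -> [_ [a Apa <-] pnE]] := pE n.+1 isT.
  have [_ -> [_ [v Bxv <-] xnE]] := xE n.+1 isT.
  apply: (@tseng_penalty_step _ _ inner inner_norm _ (beta n.+1) _ _ eta^-1
    (p n.+1) _ _ a v (D (x n.+1)) (D (p n.+1)) _ a0 (D z)) => //.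
  + exact: lambda_gt0.
  + exact: ltW.
  + by rewrite -ler_pdivlMr// div1r.
  + by rewrite pnE yE.
  + by rewrite xnE qE// yE// opprB (addrC (x n.+1)) subrK scalerBr addrCA.
  + exact: (D_lip (p n.+1, x n.+1)).
  + exact: A_strong.
  + exact: D_mono.
  + have beta_neq0 : beta n.+1 != 0 by rewrite gt_eqF// beta_gt0.
    rewrite -lee_fin fineK ?nneseries1_fin_num//.
    apply: le_trans (lee_wpmul2l (lb_ge0 n) (fitzpatrick_gap_ge (beta_Nr n) Bxv)).
    rewrite -EFinM lee_fin innerZl le_eqVlt; apply/orP; left.
    by apply/eqP; field.
- have := is_cvg_seriesZ (k := 2) (is_cvg_seriesD (is_cvg_seriesZ (k := `|r| ^+ 2) cvg_lambda2) cvg_t).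
  exact.
Qed.
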